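(* A group $G$ is Dedekind if and only if the directed normalizing graph $\vec \Gamma_{\rm norm}(G)$ is complete.
   Context: A group is Dedekind if all of its subgroups are normal (abelian groups are included). For a group $G$, the directed normalizing graph $\vec\Gamma_{\rm norm}(G)$ is the simple directed graph with vertex set $G$ and with an arc $x\to y$ (for $x\neq y$) whenever $\langle x\rangle$ is normal in $\langle x,y\rangle$. A simple directed graph is complete if for every pair of distinct vertices $u,v$ there are both an arc from $u$ to $v$ and an arc from $v$ to $u$. *)

(* Defs.v *)
From mathcomp Require Import all_boot classical_sets.

Set Implicit Arguments.
Unset Strict Implicit.
Unset Printing Implicit Defensive.

Local Open Scope classical_set_scope.
Local Open Scope group_scope.

(* Groups are arbitrary, possibly infinite, so a subset of G is a classical    *)
(* set rather than a {set G}.                                                  *)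

Definition subgroup (G : groupType) (H : set G) : Prop := group_closed (mem H).

Definition generated (G : groupType) (X : set G) : set G :=
  smallest (@subgroup G) X.

Definition normal_in (G : groupType) (N H : set G) : Prop :=
  [/\ subgroup N, subgroup H, N `<=` H &
      forall g n, H g -> N n -> N (n ^ g)].

Definition dedekind (G : groupType) : Prop :=
  forall H : set G, subgroup H -> normal_in H [set: G].

(* With at most one arc from u to v (arc is a relation) and no loops;          *)
(* opposite arcs u -> v and v -> u may coexist.                                *)
Record simple_digraph := SimpleDigraph {
  vertex : Type;
  arc : vertex -> vertex -> Prop;
  arc_irrefl : forall u, ~ arc u u
}.

Definition complete_digraph (D : simple_digraph) : Prop :=
  forall u v : vertex D, u <> v -> arc u v /\ arc v u.

Definition norm_arc (G : groupType) (x y : G) : Prop :=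
  x <> y /\ normal_in (generated [set x]) (generated [set x; y]).

Lemma norm_arc_irrefl (G : groupType) (x : G) : ~ norm_arc x x.
Proof. by case. Qed.

Definition directed_normalizing_graph (G : groupType) : simple_digraph :=
  SimpleDigraph (@norm_arc_irrefl G).

(* Main.v *)
Require Import Defs.
From mathcomp Require Import all_boot classical_sets.

Local Open Scope classical_set_scope.
Local Open Scope group_scope.

(** If all subgroups are normal in [G], then each cyclic [<x>] is normal in every [<x,y>], so all
    arcs exist ([dedekind_norm_arc]). Conversely, normality of [H] is tested on one [n] in [H] and
    one [g] at a time: the arc from [n] to [g] puts [n ^ g] in [<n>], which lies in [H]
    ([norm_arc_conjg]). *)

Lemma subgroupP (G : groupType) (H : set G) :
  subgroup H <-> H 1 /\ forall x y, H x -> H y -> H (x / y).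
Proof.
split=> [[H1 HV]|[H1 HV]]; split; rewrite ?inE //.
- by move: H1; rewrite inE.
- by move=> x y Hx Hy; have := HV x y; rewrite !inE; apply.
- by move=> x y; rewrite !inE; apply: HV.
Qed.

Lemma subgroup_generated (G : groupType) (X : set G) : subgroup (generated X).
Proof.
apply/subgroupP; split=> [H [/subgroupP[]]//|x y Xx Xy H HX].
have /subgroupP[_ HV] := HX.1.
by apply: HV; [apply: Xx | apply: Xy].
Qed.

Lemma dedekind_normal_in (G : groupType) (N H : set G) :
  dedekind G -> subgroup N -> subgroup H -> N `<=` H -> normal_in N H.
Proof.
move=> dedG sN sH NH; split=> // g n _; have [_ _ _] := dedG N sN.
exact.
Qed.

Lemma dedekind_norm_arc (G : groupType) (x y : G) :
  dedekind G -> x <> y -> norm_arc x y.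
Proof.
move=> dedG xy; split=> //.
apply: dedekind_normal_in => //; try exact: subgroup_generated.
by apply: sub_smallest2r; [exact: subgroup_generated | move=> z; left].
Qed.

(** Conjugation by [y], an element of [<x,y>], preserves the normal subgroup [<x>]. *)
Lemma norm_arc_conjg (G : groupType) (x y : G) :
  norm_arc x y -> generated [set x] (x ^ y).
Proof.
case=> _ [_ _ _]; apply; last exact: sub_gen_smallest.
by apply: sub_gen_smallest; right.
Qed.

Theorem theorem4p1 (G : groupType) :
  dedekind G <-> complete_digraph (directed_normalizing_graph G).
Proof.
split=> [dedG x y xy|complG H sH].
  by split; apply: dedekind_norm_arc => //; apply: nesym.
split=> //; first by apply/subgroupP.
(* The graph has no loops, so [n = g] is treated apart: [n] commutes with itself. *)
move=> g n _ Hn; have [<-|/eqP ng] := eqVneq n g.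
  by rewrite conjgE mulKg.
have [/norm_arc_conjg + _] := complG n g ng.
(* [generated [set n]] is an intersection over subgroups containing [n], and [H] is one of them. *)
by apply; split=> // _ ->.
Qed.
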